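(* Let $T$ be an orientation (tournament) of the complete graph $K_8$. If there exists a vertex $v \in V(T)$ such that $id(v)=2$ or $od(v)=2$, then $\gamma^{*}(T) \leq 4$.
   Context: For a digraph $D=(V,A)$ and $v \in V$, $I(v)=\{u : (u,v)\in A\}$, $O(v)=\{u : (v,u)\in A\}$, $id(v)=|I(v)|$ and $od(v)=|O(v)|$. A subset $S \subseteq V$ is a twin dominating set of $D$ if for every vertex $v \in V - S$ there exist vertices $u_1, u_2 \in S$ (possibly equal) such that $(v,u_1)$ and $(u_2,v)$ are arcs of $D$. The twin domination number $\gamma^{*}(D)$ is the minimum cardinality of a twin dominating set of $D$. *)

(* Defs.v *)
From mathcomp Require Import all_boot.

Set Implicit Arguments.
Unset Strict Implicit.
Unset Printing Implicit Defensive.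

(* A finite digraph is a finType [V] with its arc relation [a : rel V]:
   [a u v] means that (u, v) is an arc. *)

(* No loop or 2-cycle survives: [~~ (a u u && a u u)] excludes loops. *)
Definition orientation (V : finType) (e a : rel V) : Prop :=
  (forall u v, e u v = a u v || a v u) /\ (forall u v, ~~ (a u v && a v u)).

Definition complete_graph (V : finType) : rel V := [rel u v | u != v].

Section Digraph.
Variables (V : finType) (a : rel V).

Definition in_nbr (v : V) : {set V} := [set u | a u v].
Definition out_nbr (v : V) : {set V} := [set u | a v u].
Definition indeg (v : V) : nat := #|in_nbr v|.
Definition outdeg (v : V) : nat := #|out_nbr v|.

Definition twin_dominating (S : {set V}) : bool :=
  [forall v in ~: S, exists u1 in S, exists u2 in S, a v u1 && a u2 v].

Lemma twin_dominatingT : twin_dominating [set: V].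
Proof. by apply/forall_inP => v; rewrite !inE. Qed.

(* The minimum is over a nonempty family by [twin_dominatingT]. *)
Definition twin_domination_number : nat :=
  #|[arg min_(S < [set: V] | twin_dominating S) #|S| ]|.

Lemma twin_domination_numberP :
  (exists2 S, twin_dominating S & #|S| = twin_domination_number) /\
  (forall S, twin_dominating S -> twin_domination_number <= #|S|).
Proof.
rewrite /twin_domination_number; case: arg_minnP => [|S domS minS].
  exact: twin_dominatingT.
by split; [exists S | exact: minS].
Qed.

End Digraph.

(* Main.v *)
Require Import Defs.
From mathcomp Require Import all_boot.

(** Reversing all arcs preserves twin dominating sets, so let [outdeg v = 2],
    say v -> x, v -> y and x -> y. The 5-set I(v) contains a vertex w beaten by
    at most 2 others of I(v), and the winner w' among those beats the rest of
    them, so {w, w'} dominates I(v). Then {v, y, w, w'} is twin dominating. *)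

Section Tournament.
Variables (V : finType) (a : rel V).
Hypothesis tourn : orientation (@complete_graph V) a.

Lemma tournament_total u v : u != v -> a u v || a v u.
Proof. by case: tourn => <-. Qed.

Lemma tournament_asym u v : a u v -> ~~ a v u.
Proof. by move=> auv; case: tourn => _ /(_ u v); rewrite auv. Qed.

Lemma tournament_irr u : a u u = false.
Proof. by apply/negbTE; case: tourn => _ /(_ u u); rewrite andbb. Qed.

(** Totality puts every other vertex of [W] on one side of [w], and asymmetry keeps the two sides
    disjoint. *)
Lemma card_tournament_nbrs (W : {set V}) w : w \in W ->
  #|W| = (#|in_nbr a w :&: W| + #|out_nbr a w :&: W|).+1.
Proof.
move=> wW; rewrite (cardsD1 w W) wW -cardsUI.
have -> : W :\ w = in_nbr a w :&: W :|: out_nbr a w :&: W.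
  apply/setP => u; rewrite !inE -andb_orl; congr (_ && _).
  have [->|/tournament_total //] := eqVneq u w.
  by rewrite tournament_irr.
suff -> : in_nbr a w :&: W :&: (out_nbr a w :&: W) = set0.
  by rewrite cards0 addn0.
apply/setP => u; rewrite !inE.
by case: (boolP (a u w)) => //= /tournament_asym/negbTE->; rewrite andbF.
Qed.

(** Double counting: both sums count the arcs inside [W], one by heads and one by tails. *)
Lemma sum_in_out_nbrs (W : {set V}) :
  \sum_(w in W) #|in_nbr a w :&: W| = \sum_(w in W) #|out_nbr a w :&: W|.
Proof.
have cardE (p : pred V) : #|[set u | p u] :&: W| = \sum_(u in W) p u.
  rewrite -sum1_card big_mkcond [RHS]big_mkcond.
  by apply: eq_bigr => u _; rewrite !inE; case: (p u); case: (u \in W).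
under eq_bigr do rewrite cardE.
rewrite exchange_big; apply: eq_bigr => u _; exact/esym/cardE.
Qed.

Lemma exists_in_le_out (W : {set V}) : W != set0 ->
  exists2 w, w \in W & #|in_nbr a w :&: W| <= #|out_nbr a w :&: W|.
Proof.
case/set0Pn => w0 w0W; apply/exists_inP; apply: contraT.
rewrite negb_exists_in => /forall_inP out_lt_in.
(* If in-degree exceeded out-degree throughout [W], the two equal sums would differ; [w0] supplies
   the strict term. *)
have: \sum_(w in W) #|out_nbr a w :&: W| < \sum_(w in W) #|in_nbr a w :&: W|.
  rewrite (bigD1 w0) //= [ltnRHS](bigD1 w0) //= -addSn leq_add //.
    by rewrite ltnNge out_lt_in.
  by apply: leq_sum => w /andP[/out_lt_in]; rewrite -ltnNge => /ltnW.
by rewrite sum_in_out_nbrs ltnn.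
Qed.

(** A vertex with in-degree at most its out-degree in [W], the two adding up to at most 1, has
    in-degree 0. *)
Lemma dominating_vertex (W : {set V}) : 0 < #|W| <= 2 ->
  exists2 w, w \in W & W \subset w |: out_nbr a w.
Proof.
case/andP=> W_gt0 W_le2.
have [|w wW in_le_out] := @exists_in_le_out W; first by rewrite -card_gt0.
have in0 : #|in_nbr a w :&: W| = 0.
  move: W_le2; rewrite (card_tournament_nbrs _ _ wW) ltnS => le1.
  by case: #|in_nbr a w :&: W| in_le_out le1 => [//|m]; case: #|_| => // k _;
     rewrite addSn addnS.
exists w => //; apply/subsetP => u uW; rewrite !inE.
have [//|/tournament_total/orP[auw|->//]] := eqVneq u w.
by move/eqP: in0; rewrite cards_eq0 => /eqP/setP/(_ u); rewrite !inE auw uW.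
Qed.

Lemma dominating_pair (W : {set V}) : 0 < #|W| <= 5 ->
  exists w w', W \subset [set w; w'] :|: (out_nbr a w :|: out_nbr a w').
Proof.
case/andP=> W_gt0 W_le5.
have [|w wW in_le_out] := @exists_in_le_out W; first by rewrite -card_gt0.
have in_le2 : #|in_nbr a w :&: W| <= 2.
  (* Otherwise both degrees of [w] within [W] are at least 3, which forces at least 7 vertices. *)
  rewrite leqNgt; apply/negP => in_gt2; move: W_le5.
  rewrite (card_tournament_nbrs _ _ wW) ltnS leqNgt => /negP; apply.
  by apply: leq_trans (leq_add in_gt2 (leq_trans in_gt2 in_le_out)).
have splitW u : u \in W -> [|| u == w, a w u | u \in in_nbr a w :&: W].
  move=> uW; rewrite !inE uW andbT.
  by have [//|/tournament_total/orP[]->] := eqVneq u w; rewrite ?orbT.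
have [in0|in_neq0] := eqVneq (in_nbr a w :&: W) set0.
  (* Nothing in [W] beats [w], so the pair degenerates to [w] alone. *)
  exists w, w; apply/subsetP => u /splitW; rewrite in0 !inE.
  by case/or3P => // ->; rewrite ?orbT.
have [|w' _ /subsetP dom] := @dominating_vertex (in_nbr a w :&: W).
  by rewrite card_gt0 in_neq0.
exists w, w'; apply/subsetP => u /splitW/or3P[|| /dom]; rewrite !inE.
- by move->.
- by move->; rewrite ?orbT.
- by case/orP=> ->; rewrite ?orbT.
Qed.

End Tournament.

Lemma orientation_rev (V : finType) (a : rel V) :
  orientation (@complete_graph V) a ->
  orientation (@complete_graph V) [rel u v | a v u].
Proof.
by case=> tot asym; split=> u v /=; [rewrite tot orbC | rewrite andbC asym].
Qed.

(** Reversal only swaps the roles of the two witnesses. *)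
Lemma twin_dominating_rev (V : finType) (a : rel V) (S : {set V}) :
  twin_dominating [rel u v | a v u] S -> twin_dominating a S.
Proof.
move=> /forall_inP dom; apply/forall_inP => v /dom.
case/exists_inP=> u1 u1S /exists_inP[u2 u2S /= /andP[au1 au2]].
by apply/exists_inP; exists u2 => //; apply/exists_inP; exists u1; rewrite ?au1 ?au2.
Qed.

Lemma twin_dominating_outdeg2 (V : finType) (a : rel V) (v : V) :
  orientation (@complete_graph V) a -> #|V| = 8 -> outdeg a v = 2 ->
  exists2 S : {set V}, twin_dominating a S & #|S| <= 4.
Proof.
move=> tourn cardV od2.
have id5 : indeg a v = 5.
  have := card_tournament_nbrs V a tourn [set: V] v (in_setT v).
  by rewrite cardsT cardV !setIT [#|out_nbr a v|]od2 addn2 => -[].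
(* In the reversed tournament a dominating vertex is a sink: the other out-neighbour of [v] has an
   arc to [y]. *)
have [|y yO /subsetP domO] :=
  dominating_vertex _ _ (orientation_rev _ _ tourn) (out_nbr a v).
  by rewrite [#|_|]od2.
have [|w [w' /subsetP domI]] := dominating_pair _ _ tourn (in_nbr a v).
  by rewrite [#|_|]id5.
exists [set v; y; w; w']; last first.
  (* Only an upper bound is claimed, since [w] and [w'] may coincide. *)
  by rewrite -!setUA !cardsU1 cards1; do 3!case: (_ \notin _).
have [vS yS wS w'S] : [/\ v \in [set v; y; w; w'], y \in [set v; y; w; w'],
    w \in [set v; y; w; w'] & w' \in [set v; y; w; w']].
  by rewrite !inE !eqxx ?orbT.
have twin u u1 u2 : u1 \in [set v; y; w; w'] -> u2 \in [set v; y; w; w'] ->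
    a u u1 -> a u2 u ->
    [exists u1 in [set v; y; w; w'], exists u2 in [set v; y; w; w'],
      a u u1 && a u2 u].
  move=> u1S u2S a1 a2; apply/exists_inP; exists u1 => //.
  by apply/exists_inP; exists u2; rewrite ?a1.
apply/forall_inP => u; rewrite !inE !negb_or -!andbA => /and4P[uv uy uw uw'].
have /orP[auv|avu] := tournament_total _ _ tourn _ _ uv.
(* An in-neighbour of [v] goes out to [v] and is entered from [w] or [w']. *)
- have := domI u; rewrite !inE auv (negbTE uw) (negbTE uw') /=.
  by case/(_ isT)/orP => [awu|aw'u]; [apply: (twin u v w) | apply: (twin u v w')].
(* An out-neighbour of [v] goes out to [y] and is entered from [v]. *)
- have := domO u; rewrite !inE avu (negbTE uy) /= => /(_ isT) auy.
  exact: (twin u y v).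
Qed.

Theorem theorem2p2 (V : finType) (a : rel V)
  (hV : #|V| = 8) (hT : orientation (@complete_graph V) a)
  (hdeg : exists v : V, indeg a v = 2 \/ outdeg a v = 2) :
  twin_domination_number a <= 4.
Proof.
suff [S domS cardS] : exists2 S : {set V}, twin_dominating a S & #|S| <= 4.
  by apply: leq_trans cardS; apply: (twin_domination_numberP a).2.
case: hdeg => v [id2|od2]; last exact: twin_dominating_outdeg2 hT hV od2.
(* [id2] fits as it stands: the out-degree in the reversed digraph is the in-degree in [a] by
   conversion. *)
have [S domS cardS] := twin_dominating_outdeg2 _ _ v (orientation_rev _ _ hT) hV id2.
by exists S => //; apply: twin_dominating_rev.
Qed.
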